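(* Let $m\geq 1$ and let $G_1,\ldots,G_m$ be connected finite simple graphs, each containing at least one edge. Let $\bigvee_{i=1}^{m}G_i$ be a finite iterated wedge of them. Then $$\operatorname{gscat}\left(\bigvee_{i=1}^{m}G_i\right)=\max_{1\leq i\leq m}\operatorname{gscat}(G_i),$$ where $\operatorname{gscat}$ denotes the simplicial geometric category.
   Context: All graphs are finite and simple; all simplicial complexes are finite abstract simplicial complexes. A graph is regarded as a simplicial complex of dimension at most one (its vertices and edges being the simplices) whenever $\operatorname{gscat}$ is applied to it. Strong collapse: let $K$ be a simplicial complex and $u\neq v$ vertices of $K$. The vertex $v$ is dominated by $u$ if every maximal simplex of $K$ containing $v$ also contains $u$. In this case, deleting $v$ together with all simplices containing it is called an elementary strong collapse. A strong collapse is a finite sequence of elementary strong collapses. $K$ is strongly collapsible if it strongly collapses to a single vertex (a single vertex is itself strongly collapsible). Simplicial geometric category: $\operatorname{gscat}(K)$ is the least integer $m\geq 0$ such that $K=C_0\cup C_1\cup\cdots\cup C_m$, where each $C_i$ is a strongly collapsible subcomplex of $K$. Wedge: if $K$ and $L$ are graphs sharing exactly one vertex $v$ and otherwise disjoint, then $K\vee_v L$ is their union, i.e. the graph with vertex set $V(K)\cup V(L)$ and edge set $E(K)\cup E(L)$. More generally, one chooses a vertex in each of two disjoint graphs and identifies the two chosen vertices. Iterated wedge: $\bigvee_{i=1}^{m}G_i$ denotes a graph $W_m$ obtained by $W_1=G_1$ and, for $2\le k\le m$, $W_k=W_{k-1}\vee_{v_k} G_k$, where at each step the wedge is formed by identifying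 some chosen vertex of $W_{k-1}$ with some chosen vertex of $G_k$ (the choice of vertices being arbitrary). *)

(* Defs.v *)
From mathcomp Require Import all_boot.

Set Implicit Arguments.
Unset Strict Implicit.
Unset Printing Implicit Defensive.

Section Complexes.

Variable T : finType.
Implicit Types (K L : {set {set T}}) (s : {set T}) (u v : T).

(* Simplices are nonempty; [T] is only an ambient set of labels, and the
   vertices of [K] are the [v : T] such that [[set v] \in K]. *)
Definition is_complex K : bool :=
  (set0 \notin K) &&
  [forall s in K, forall t : {set T}, (t \subset s) && (t != set0) ==> (t \in K)].

Record complex := Complex {faces :> {set {set T}}; complexP : is_complex faces}.

Definition maximal_simplex K s : bool :=
  (s \in K) && [forall t in K, (s \subset t) ==> (t == s)].

Definition dominated K v u : bool :=
  [&& [set v] \in K, [set u] \in K, u != v &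
      [forall s, maximal_simplex K s && (v \in s) ==> (u \in s)]].

Definition delete_vertex K v : {set {set T}} := [set s in K | v \notin s].

Definition elementary_strong_collapse : rel {set {set T}} :=
  fun K L => [exists v, exists u, dominated K v u && (L == delete_vertex K v)].

Definition strong_collapse : rel {set {set T}} :=
  connect elementary_strong_collapse.

Definition strongly_collapsible K : bool :=
  [exists v, strong_collapse K [set [set v]]].

Definition subcomplex L K : bool := is_complex L && (L \subset K).

Definition gscat_cover K (m : nat) : bool :=
  [exists C : {ffun 'I_m.+1 -> {set {set T}}},
    [forall i, subcomplex (C i) K && strongly_collapsible (C i)]
    && (K == \bigcup_(i < m.+1) C i)].

Definition full_simplex s : {set {set T}} := [set t in powerset s | t != set0].

Lemma full_simplex_complex s : is_complex (full_simplex s).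
Proof.
apply/andP; split; first by rewrite !inE eqxx andbF.
apply/forallP => t; apply/implyP; rewrite !inE => /andP[ts _].
apply/forallP => r; apply/implyP => /andP[rt r0].
by rewrite !inE r0 (subset_trans rt ts).
Qed.

Lemma full_simplex_strongly_collapsible s :
  s != set0 -> strongly_collapsible (full_simplex s).
Proof.
case/set0Pn => u us; apply/existsP; exists u.
have [n] := ubnP #|s|; elim: n s us => // n IHn s us /ltnSE-les.
have [->|neq] := eqVneq s [set u].
  rewrite (_ : full_simplex _ = [set [set u]]) /strong_collapse ?connect0 //.
  apply/setP => t; rewrite !inE subset1; case: eqVneq => [->|_] /=.
    by apply/set0Pn; exists u; rewrite inE.
  by case: eqP.
have [v vs vu] : exists2 v, v \in s & v != u.
  apply/exists_inP; apply: contraR neq => /exists_inPn h.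
  rewrite eqEsubset sub1set us andbT; apply/subsetP => v /h.
  by rewrite negbK inE.
apply: (@connect_trans _ _ (full_simplex (s :\ v))); last first.
  apply: IHn; first by rewrite !inE eq_sym vu.
  by rewrite (cardsD1 v) vs in les.
apply/connect1/existsP; exists v; apply/existsP; exists u; apply/andP; split.
  have n0 (w : T) : [set w] != set0 by apply/set0Pn; exists w; rewrite inE.
  rewrite /dominated !inE !sub1set vs us !n0 eq_sym vu /=.
  apply/forallP => t; apply/implyP => /andP[/andP[]].
  rewrite !inE => /andP[ts _] /forallP /(_ s); rewrite !inE subxx ts /=.
  by have -> : s != set0 by [apply/set0Pn; exists u]; move=> /= /eqP <-.
apply/eqP/setP => t; rewrite !inE subsetD1.
by case: (t \subset s); case: (v \in t); case: (t == set0).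
Qed.

Lemma gscat_exists (K : complex) :
  exists m, (K == set0 :> {set {set T}}) || gscat_cover K m.
Proof.
have [//|[s0 s0K]] := set_0Vmem K; first by move=> ->; exists 0; rewrite eqxx.
have /andP[K0 /forall_inP Kd] := complexP K.
have Kn s : s \in (K : {set _}) -> s != set0 by apply: contraTneq => ->.
exists #|K|; apply/orP; right; apply/existsP.
pose F (i : 'I_#|K|.+1) := nth s0 (enum K) i.
have FK i : F i \in (K : {set _}).
  rewrite /F; case: (ltnP i (size (enum K))) => h; last by rewrite nth_default.
  by rewrite -mem_enum mem_nth.
have subK s : s \in (K : {set _}) -> full_simplex s \subset K.
  move=> sK; apply/subsetP => t; rewrite !inE => ht.
  by have /forallP /(_ t) := Kd s sK; rewrite ht.
exists [ffun i => full_simplex (F i)]; apply/andP; split.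
  apply/forallP => i; rewrite ffunE /subcomplex full_simplex_complex subK //=.
  exact/full_simplex_strongly_collapsible/Kn.
rewrite eqEsubset; apply/andP; split; last first.
  by apply/bigcupsP => i _; rewrite ffunE subK.
apply/subsetP => s sK; apply/bigcupP.
have h : index s (enum K) < #|K|.+1 by rewrite ltnS cardE index_size.
exists (Ordinal h) => //.
by rewrite ffunE /F /= nth_index ?mem_enum // !inE subxx Kn.
Qed.

(* The empty complex has no cover by strongly collapsible subcomplexes; it
   receives the junk value 0. *)
Definition gscat (K : complex) : nat := ex_minn (gscat_exists K).

End Complexes.

Record sgraph := SGraph {
  vertex :> finType;
  edge : rel vertex;
  edge_sym : symmetric edge;
  edge_irr : irreflexive edge }.

Definition connected_graph (G : sgraph) : Prop :=
  0 < #|G| /\ forall x y : G, connect (@edge G) x y.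

Definition has_edge (G : sgraph) : Prop := exists x y : G, edge x y.

Definition graph_faces (G : sgraph) : {set {set G}} :=
  [set [set x] | x : G] :|: [set [set e.1; e.2] | e : G * G & edge e.1 e.2].

Lemma graph_is_complex (G : sgraph) : is_complex (graph_faces G).
Proof.
have n0 (w : G) A : w |: A != set0 by apply/set0Pn; exists w; rewrite !inE eqxx.
have n1 (w : G) : [set w] != set0 by apply/set0Pn; exists w; rewrite !inE.
have f1 (x : G) : [set x] \in graph_faces G.
  by rewrite inE; apply/orP; left; apply/imsetP; exists x.
apply/andP; split.
  rewrite inE negb_or; apply/andP; split; apply/negP.
    by case/imsetP => x _ /esym/eqP; rewrite (negPf (n1 x)).
  by case/imsetP => e _ /esym/eqP; rewrite (negPf (n0 e.1 _)).
apply/forall_inP => s sG; apply/forallP => t; apply/implyP => /andP[ts t0].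
have [/imsetP[x _ sE]|/imsetP[[x y] /= _ sE]] := setUP sG; move: ts; rewrite {1}sE.
  by rewrite subset1 (negPf t0) orbF => /eqP ->.
move=> ts; case xt: (x \in t); case yt: (y \in t).
- suff -> : t = s by [].
  by apply/eqP; rewrite eqEsubset sE ts subUset !sub1set xt yt.
- suff -> : t = [set x] by [].
  apply/eqP; rewrite eqEsubset sub1set xt andbT; apply/subsetP => z zt.
  have := subsetP ts z zt; rewrite !inE => /orP[//|/eqP zy].
  by rewrite -zy zt in yt.
- suff -> : t = [set y] by [].
  apply/eqP; rewrite eqEsubset sub1set yt andbT; apply/subsetP => z zt.
  have := subsetP ts z zt; rewrite !inE => /orP[/eqP zx|//].
  by rewrite -zx zt in xt.
- case/set0Pn: t0 => z zt; have := subsetP ts z zt; rewrite !inE.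
  by case/orP => /eqP zE; rewrite -zE zt in xt yt.
Qed.

Definition graph_complex (G : sgraph) : complex G := Complex (graph_is_complex G).

(* [W] is the union of a copy [f K] of [K] and a copy [g L] of [L] which meet
   exactly in the vertex [f x = g y].  This covers both the union of two graphs
   sharing a single vertex and the gluing of two disjoint graphs, whatever
   labels are used for the vertices of the result. *)
Definition wedge_at (K L : sgraph) (x : K) (y : L) (W : sgraph) : Prop :=
  exists (f : K -> W) (g : L -> W),
    [/\ injective f /\ injective g,
        f x = g y,
        [set f a | a : K] :&: [set g b | b : L] = [set f x],
        [set f a | a : K] :|: [set g b | b : L] = [set: W] &
        forall p q : W, edge p q <->
          (exists a a' : K, [/\ edge a a', f a = p & f a' = q]) \/
          (exists b b' : L, [/\ edge b b', g b = p & g b' = q])].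

(* [iterated_wedge G m W]: [W] is obtained from [G 1, ..., G m] (the other
   values of [G] are irrelevant). *)
Inductive iterated_wedge (G : nat -> sgraph) : nat -> sgraph -> Prop :=
| iterated_wedge1 : iterated_wedge G 1 (G 1)
| iterated_wedgeS (k : nat) (W W' : sgraph) (x : W) (y : G k.+1) :
    iterated_wedge G k W -> wedge_at x y W' -> iterated_wedge G k.+1 W'.

(* Main.v *)
(* In a complex of dimension at most one a dominated vertex is a leaf, so the
   strongly collapsible subcomplexes of a graph are its subtrees, and gscat + 1
   is the least number of subtrees covering the graph.  In a connected graph
   the covering trees may be taken to be spanning; gluing the i-th spanning trees
   of K and L at the wedge point gives a cover of the wedge.  Conversely a
   subtree of the wedge meets K in a subtree or not at all, so a cover of the
   wedge restricts to a cover of K. *)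
Require Import Defs.
From mathcomp Require Import all_boot.

Set Implicit Arguments.
Unset Strict Implicit.
Unset Printing Implicit Defensive.

(** * Trees as complexes, and strong collapsibility in dimension at most one *)

Section TreeComplexes.

Variable T : finType.
Implicit Types (C D : {set {set T}}) (s t : {set T}) (u v x : T).

Definition add_leaf C u v := [set v] |: ([set u; v] |: C).

(** Trees grown leaf by leaf, the reverse of a strong collapse to a vertex. Taking [u] inside and
    [v] outside [C] keeps the complex connected and acyclic. *)
Inductive tree_complex : {set {set T}} -> Prop :=
| tree_complex1 v : tree_complex [set [set v]]
| tree_complex_leaf C u v :
    tree_complex C -> [set u] \in C -> [set v] \notin C ->
    tree_complex (add_leaf C u v).

Lemma set1_neq0 v : [set v] != set0.
Proof. by rewrite -card_gt0 cards1. Qed.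

Lemma is_complexP C :
  reflect (set0 \notin C /\
           forall s t, s \in C -> t \subset s -> t != set0 -> t \in C)
          (is_complex C).
Proof.
apply: (iffP andP) => [[C0 /forall_inP CP]|[C0 CP]]; split=> //.
  by move=> s t sC ts t0; have /forallP/(_ t) := CP s sC; rewrite ts t0.
apply/forall_inP => s sC; apply/forallP => t; apply/implyP => /andP[].
exact: CP sC.
Qed.

Lemma complex_vertex C s v : is_complex C -> s \in C -> v \in s -> [set v] \in C.
Proof.
by move=> /is_complexP[_ CP] sC vs; apply: CP sC _ _; rewrite ?sub1set ?set1_neq0.
Qed.

Lemma subset_set2 t u v : t \subset [set u; v] -> t != set0 ->
  [\/ t = [set u], t = [set v] | t = [set u; v]].
Proof.
move=> tuv t0; case ut: (u \in t); case vt: (v \in t).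
- by constructor 3; apply/eqP; rewrite eqEsubset tuv subUset !sub1set ut.
- constructor 1; apply/eqP; rewrite eqEsubset sub1set ut andbT.
  apply/subsetP => z zt; have := subsetP tuv z zt; rewrite !inE => /orP[//|/eqP zv].
  by rewrite -zv zt in vt.
- constructor 2; apply/eqP; rewrite eqEsubset sub1set vt andbT.
  apply/subsetP => z zt; have := subsetP tuv z zt; rewrite !inE => /orP[/eqP zu|//].
  by rewrite -zu zt in ut.
- case/set0Pn: t0 => z zt; have := subsetP tuv z zt; rewrite !inE.
  by case/orP => /eqP zE; rewrite -zE zt in ut vt.
Qed.

Lemma tree_complex_is_complex C : tree_complex C -> is_complex C.
Proof.
elim=> {C} [v|C u v _ /is_complexP[C0 CP] uC vC]; apply/is_complexP; split.
- by rewrite inE eq_sym set1_neq0.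
- by move=> s t /set1P -> ; rewrite subset1 => /orP[/eqP->|->]; rewrite ?inE.
- by rewrite !inE negb_or eq_sym set1_neq0 negb_or C0 andbT eq_sym -card_gt0 cards2.
move=> s t; rewrite 2!in_setU1 => /or3P[/eqP->|/eqP->|sC] ts t0.
- by move: ts; rewrite subset1 (negPf t0) orbF => /eqP ->; rewrite !inE eqxx.
- by case: (subset_set2 ts t0) => ->; rewrite 2!in_setU1 ?eqxx ?uC ?orbT.
- by rewrite 2!in_setU1 (CP s t) ?orbT.
Qed.

(** [C] is closed under faces, so no simplex of [C] contains [v]. Hence the edge [[set u; v]] is the
    only maximal simplex through [v], and [u] dominates [v]. *)
Lemma add_leaf_collapse C u v :
  is_complex C -> [set u] \in C -> [set v] \notin C ->
  elementary_strong_collapse (add_leaf C u v) C.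
Proof.
move=> Cc uC vC; have uv : u != v by apply: contraNneq vC => <-.
apply/existsP; exists v; apply/existsP; exists u; apply/andP; split.
  rewrite /dominated uv !in_setU1 eqxx uC !orbT /=.
  apply/forallP => s; apply/implyP => /andP[/andP[]].
  rewrite 2!in_setU1 => /or3P[/eqP->|/eqP->|sC].
  - move=> /forall_inP/(_ [set u; v]); rewrite 2!in_setU1 eqxx orbT => /(_ isT).
    by rewrite sub1set set22 /= => /eqP <-; rewrite set21.
  - by rewrite set21.
  - by move=> _ /(complex_vertex Cc sC); rewrite (negPf vC).
apply/eqP/setP => s; rewrite inE 2!in_setU1.
case: eqVneq => [->|_]; first by rewrite set11 (negPf vC).
case: eqVneq => [->|_].
  rewrite set22; apply/negP => /(complex_vertex Cc) /(_ (set22 u v)).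
  exact/negP.
case sC: (s \in C) => //=; apply/esym/negP => /(complex_vertex Cc sC).
exact/negP.
Qed.

Lemma tree_complex_strongly_collapsible C :
  tree_complex C -> strongly_collapsible C.
Proof.
elim=> {C} [v|C u v tC /existsP[r Cr] uC vC]; apply/existsP.
  by exists v; apply: connect0.
exists r; apply: connect_trans Cr; apply: connect1.
exact: add_leaf_collapse (tree_complex_is_complex tC) uC vC.
Qed.

Lemma maximal_simplex_above C s :
  s \in C -> exists2 t, maximal_simplex C t & s \subset t.
Proof.
move=> sC; case: (@arg_maxnP _ s (fun t => (t \in C) && (s \subset t))
  (fun t : {set T} => #|t|)); first by rewrite sC /=.
move=> t /andP[tC st] tmax; exists t => //; rewrite /maximal_simplex tC /=.
apply/forall_inP => r rC; apply/implyP => tr.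
by rewrite eq_sym eqEcard tr; apply: tmax; rewrite rC (subset_trans st tr).
Qed.

(** A maximal simplex above [[set v]] contains [u], so the edge [[set u; v]] is in [C]. Any simplex
    through [v] other than [[set v]] has two vertices, hence is maximal by the dimension bound,
    contains [u] and equals that edge. *)
Lemma dominated_add_leaf C u v :
  is_complex C -> {in C, forall s, #|s| <= 2} -> dominated C v u ->
  C = add_leaf (delete_vertex C v) u v.
Proof.
move=> Cc Cd /and4P[vC uC uv /forallP dom].
have udom s : maximal_simplex C s -> v \in s -> u \in s.
  by move=> sm vs; have := dom s; rewrite sm vs.
have uvC : [set u; v] \in C.
  have [t tm vt] := maximal_simplex_above vC; rewrite sub1set in vt.
  have /is_complexP[_ CP] := Cc; have /andP[tC _] := tm.
  apply: CP tC _ _; first by rewrite subUset !sub1set vt udom.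
  by rewrite -card_gt0 cards2.
apply/setP => s; rewrite 2!in_setU1 inE.
case: eqVneq => [->|sv]; first by rewrite vC.
case: eqVneq => [->|suv]; first by rewrite uvC.
case sC: (s \in C) => //=; apply/esym; apply/negP => vs.
have /negP[] : ~~ (u \in s).
  apply: contra suv => us; rewrite eq_sym eqEcard subUset !sub1set us vs cards2 uv.
  exact: Cd.
apply: (udom _ _ vs); rewrite /maximal_simplex sC /=.
apply/forall_inP => t tC; apply/implyP => st; rewrite eq_sym eqEcard st /=.
apply: leq_trans (Cd t tC) _; rewrite leqNgt; apply: contra sv => s1.
by rewrite eq_sym eqEcard sub1set vs cards1.
Qed.

(** Read backwards, each elementary collapse attaches a leaf; the induction runs along the
    collapsing path. *)
Lemma strongly_collapsible_tree_complex C :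
  is_complex C -> {in C, forall s, #|s| <= 2} -> strongly_collapsible C ->
  tree_complex C.
Proof.
move=> Cc Cd /existsP[r /connectP[p]].
elim: p C Cc Cd => [|D p IHp] C Cc Cd /=; first by move=> _ <-; constructor.
case/andP=> /existsP[v /existsP[u /andP[dom /eqP DE]]] pD rE.
have tD : tree_complex D.
  apply: IHp => // [|s]; last by rewrite DE inE => /andP[/Cd].
  have /is_complexP[C0 CP] := Cc; rewrite DE; apply/is_complexP; split.
    by rewrite inE (negPf C0).
  move=> s t; rewrite !inE => /andP[sC vs] ts t0.
  by rewrite (CP s) //=; apply: contra vs => /(subsetP ts).
rewrite (dominated_add_leaf Cc Cd dom) -DE; case/and4P: dom => vC uC uv _.
by constructor; rewrite // DE inE ?uC ?vC inE ?eqxx // eq_sym.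
Qed.

(* When the new leaf [v] of [D] is the gluing vertex, the edge [u v] is moved
   over to [C], so that the gluing vertex becomes [u]. *)
Lemma tree_complexU C D x :
  tree_complex C -> tree_complex D -> [set x] \in C -> [set x] \in D ->
  (forall v, [set v] \in C -> [set v] \in D -> v = x) ->
  tree_complex (C :|: D).
Proof.
move=> tC tD; elim: tD C x tC => {D} [w|D u v tD IH uD vD] C x tC xC.
  by move=> /set1P <- _; rewrite (setUidPl _) // sub1set.
rewrite 2!in_setU1 => xD CD.
have uv : u != v by apply: contraNneq vD => <-.
have inDl w : [set w] \in D -> [set w] \in add_leaf D u v.
  by move=> wD; rewrite 2!in_setU1 wD !orbT.
have vDl : [set v] \in add_leaf D u v by rewrite setU11.
have [xv|xv] := eqVneq x v.
  subst x.
  have uC : [set u] \notin C.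
    by apply: contraNN uv => uC; apply/eqP/CD => //; apply: inDl.
  have -> : C :|: add_leaf D u v = add_leaf C v u :|: D.
    apply/setP => s; rewrite !(inE, in_setU1) (setUC [set v]).
    do 2?[case: eqVneq => [->|_]]; rewrite ?xC ?orbT //.
    by case: eqVneq => [->|_]; rewrite ?uD ?orbT.
  apply: (IH _ u) => //.
  - by constructor.
  - by rewrite setU11.
  move=> w; rewrite 2!in_setU1 => /or3P[/eqP/set1_inj //|/eqP E|wC] wD.
    by have := cards1 w; rewrite E cards2 eq_sym uv.
  by have := CD w wC (inDl _ wD) => wv; rewrite wv (negPf vD) in wD.
have {}xD : [set x] \in D.
  case/or3P: xD => // /eqP; first by move/set1_inj/eqP; rewrite (negPf xv).
  by move=> E; have := cards1 x; rewrite E cards2 uv.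
(* Here the leaf [v] is not the gluing vertex, so it can be attached after the union. It is not in
   [C], because a vertex common to both trees equals [x]. *)
have -> : C :|: add_leaf D u v = add_leaf (C :|: D) u v by rewrite setUCA (setUCA C).
constructor; first by apply: (IH _ x) => // w wC /inDl; apply: CD.
  by rewrite inE uD orbT.
rewrite inE (negPf vD) orbF; apply: contra xv => /CD /(_ vDl) ->.
by rewrite eqxx.
Qed.

End TreeComplexes.

Lemma tree_complex_imset (T T' : finType) (f : T -> T') (C : {set {set T}}) :
  injective f -> tree_complex C -> tree_complex [set f @: s | s : {set T} in C].
Proof.
move=> fI; elim=> {C} [v|C u v _ IH uC vC]; first by rewrite !imset_set1; constructor.
rewrite /add_leaf !imsetU1 imset_set1; constructor=> //.
  by rewrite -imset_set1 imset_f.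
by rewrite -imset_set1 (mem_imset _ _ (imset_inj fI)).
Qed.

(** * Covers of a graph by trees and by spanning trees *)

Section GraphFaces.

Variable G : sgraph.
Implicit Types (C : {set {set G}}) (s : {set G}).

Lemma graph_facesP s :
  reflect ((exists x, s = [set x]) \/ exists x y : G, edge x y /\ s = [set x; y])
          (s \in graph_faces G).
Proof.
apply: (iffP setUP) => -[].
- by case/imsetP => x _ ->; left; exists x.
- by case/imsetP => -[x y]; rewrite inE => exy ->; right; exists x, y.
- by case=> x ->; left; apply: imset_f.
- by case=> x [y [exy ->]]; right; apply/imsetP; exists (x, y); rewrite ?inE.
Qed.

Lemma graph_faces1 (x : G) : [set x] \in graph_faces G.
Proof. by apply/graph_facesP; left; exists x. Qed.

Lemma graph_faces2 (x y : G) : edge x y -> [set x; y] \in graph_faces G.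
Proof. by move=> exy; apply/graph_facesP; right; exists x, y. Qed.

Lemma graph_faces_edge (x y : G) : x != y -> [set x; y] \in graph_faces G -> edge x y.
Proof.
move=> xy /graph_facesP[[z E]|[a [b [eab E]]]].
  by have := cards1 z; rewrite -E cards2 xy.
have: x \in [set a; b] by rewrite -E set21.
have: y \in [set a; b] by rewrite -E set22.
rewrite !inE => /orP[]/eqP yE /orP[]/eqP xE; rewrite ?xE ?yE // in xy *.
- by rewrite eqxx in xy.
- by rewrite edge_sym.
- by rewrite eqxx in xy.
Qed.

Lemma card_graph_face s : s \in graph_faces G -> #|s| <= 2.
Proof.
case/graph_facesP => [[x ->]|[x [y [_ ->]]]]; first by rewrite cards1.
by rewrite cards2; case: (_ != _).
Qed.

(** Grows a subtree into a spanning tree, by induction on the number of vertices still missing. *)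
Lemma tree_complex_extend C :
  connected_graph G -> tree_complex C -> C \subset graph_faces G ->
  exists2 D, tree_complex D /\ D \subset graph_faces G &
    C \subset D /\ forall v, [set v] \in D.
Proof.
move=> [_ Gc]; have [n] := ubnP #|[set v | [set v] \notin C]|.
elim: n C => // n IHn C Cn tC CG.
have [w wC|all_in] := pickP [pred v | [set v] \notin C]; last first.
  by exists C => //; split=> // v; have := all_in v => /= /negbFE.
have [r rC] : exists r, [set r] \in C.
  by case: tC => [v|C' u v _ _ _]; exists v; rewrite ?setU11 ?set11.
(* A path from the tree vertex [r] to the missing vertex [w] has a first edge leaving [C]; its far
   end is the next leaf. *)
have [u [v [uC vC euv]]] : exists u v, [/\ [set u] \in C, [set v] \notin C & edge u v].
  have /connectP[p] := Gc r w; elim: p r rC => [|z p IHp] r rC /=.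
    by move=> _ wE; rewrite /= wE rC in wC.
  case/andP=> erz; have [zC|zC] := boolP ([set z] \in C); first exact: IHp.
  by exists r, z.
have [|||D [tD DG] [CD Dall]] := IHn (add_leaf C u v).
- rewrite ltnS in Cn; apply: leq_trans Cn; apply: proper_card; apply/properP; split.
    by apply/subsetP => z; rewrite !inE !negb_or => /and3P[].
  by exists v; rewrite !inE ?eqxx.
- by constructor.
- by rewrite !subUset !sub1set graph_faces1 graph_faces2.
exists D => //; split=> //; apply: subset_trans CD.
by rewrite /add_leaf setUA subsetUr.
Qed.

Lemma gscat_leP n : 0 < #|G| ->
  reflect (exists2 C : 'I_n.+1 -> {set {set G}}, forall i, tree_complex (C i) &
             graph_faces G = \bigcup_i C i)
          (gscat (graph_complex G) <= n).
Proof.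
move=> Gpos; rewrite /gscat; case: ex_minnP => k.
(* A nonempty graph has a face, which rules out the junk value of [gscat] at the empty complex. *)
have /set0Pn/negPf G0 : exists s, s \in graph_faces G.
  by case/card_gt0P: Gpos => v _; exists [set v]; apply: graph_faces1.
rewrite /= G0 /= => kG kmin; apply: (iffP idP) => [kn|[C tC CE]]; last first.
  apply: kmin; apply/existsP; exists [ffun i => C i].
  have -> : \bigcup_(i < n.+1) [ffun i => C i] i = \bigcup_i C i.
    by apply: eq_bigr => i _; rewrite ffunE.
  rewrite CE eqxx andbT; apply/forallP => i; rewrite ffunE.
  rewrite /subcomplex tree_complex_is_complex //= bigcup_sup //=.
  exact: tree_complex_strongly_collapsible.
have /existsP[C /andP[/forallP CP /eqP CE]] := kG.
(* The given cover has only the indices [0] to [k]; its last member is repeated to obtain [n.+1]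
   trees. *)
exists (fun i : 'I_n.+1 => C (inord (minn i k))) => [i|].
  have /andP[/andP[Cc CG] Csc] := CP (inord (minn i k)).
  apply: strongly_collapsible_tree_complex => // s /(subsetP CG).
  exact: card_graph_face.
apply/eqP; rewrite CE eqEsubset; apply/andP; split; apply/bigcupsP => i _.
  have ik : i <= k by rewrite -ltnS.
  apply: (bigcup_max (widen_ord (kn : k.+1 <= n.+1) i)) => //=.
  by rewrite (minn_idPl ik) inord_val.
by apply: bigcup_sup.
Qed.

(** Enlarging the covering trees inside the graph keeps them a cover. Spanning trees all contain the
    wedge point, which lets two covers be glued member by member. *)
Lemma gscat_le_spanning n : connected_graph G -> gscat (graph_complex G) <= n ->
  exists2 C : 'I_n.+1 -> {set {set G}},
    forall i, tree_complex (C i) /\ forall v, [set v] \in C i &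
    graph_faces G = \bigcup_i C i.
Proof.
move=> Gc /gscat_leP[|C tC CE]; first by case: Gc.
have CG i : C i \subset graph_faces G by rewrite CE bigcup_sup.
have /fin_all_exists2[D DP CD] i := tree_complex_extend Gc (tC i) (CG i).
exists D => [i|]; first by split; [case: (DP i) | case: (CD i)].
apply/eqP; rewrite eqEsubset; apply/andP; split; last first.
  by apply/bigcupsP => i _; case: (DP i).
rewrite CE; apply/bigcupsP => i _; apply: (bigcup_max i) => //.
by case: (CD i).
Qed.

End GraphFaces.

(** * Restricting trees and covers of a wedge to one factor *)

(** The body of [wedge_at] with the two embeddings as parameters, so that they can be fixed in a
    section and exchanged. *)
Definition wedge_maps (K L W : sgraph) (x : K) (y : L) (f : K -> W) (g : L -> W) :=
  [/\ injective f /\ injective g,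
      f x = g y,
      [set f a | a : K] :&: [set g b | b : L] = [set f x],
      [set f a | a : K] :|: [set g b | b : L] = [set: W] &
      forall p q : W, edge p q <->
        (exists a a' : K, [/\ edge a a', f a = p & f a' = q]) \/
        (exists b b' : L, [/\ edge b b', g b = p & g b' = q])].

(** This symmetry carries results about the left factor over to the right one. *)
Lemma wedge_mapsC (K L W : sgraph) (x : K) (y : L) (f : K -> W) (g : L -> W) :
  wedge_maps x y f g -> wedge_maps y x g f.
Proof.
case=> [[fI gI] fx fgI fgU fgE]; split=> //; first by rewrite setIC fgI fx.
  by rewrite setUC.
by move=> p q; split=> [/fgE[]|[] h]; [right|left|apply/fgE; right|apply/fgE; left].
Qed.

(** For injective [f], the part of [C] lying in the image of [f], written in the labels of [T]. *)
Definition pullback (T T' : finType) (f : T -> T') (C : {set {set T'}}) :=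
  [set s : {set T} | f @: s \in C].

Section WedgeLeft.

Variables (K L W : sgraph) (x : K) (y : L) (f : K -> W) (g : L -> W).
Hypothesis fgW : wedge_maps x y f g.

Lemma wedge_injl : injective f. Proof. by case: fgW => -[]. Qed.

Lemma wedge_meet a b : f a = g b -> a = x.
Proof.
case: fgW => _ _ fgI _ _ ab; apply: wedge_injl; apply/set1P.
by rewrite -fgI inE imset_f //= ab imset_f.
Qed.

Lemma wedge_edgel a a' : edge a a' -> edge (f a) (f a').
Proof. by case: fgW => _ _ _ _ fgE aa'; apply/fgE; left; exists a, a'. Qed.

(** An edge coming from [L] would have both ends at the wedge point and so be a loop. *)
Lemma wedge_edgel_inv a a' : edge (f a) (f a') -> edge a a'.
Proof.
case: (fgW) => [[fI gI] fx _ _ fgE] /[dup] eaa' /fgE[[b [b' [ebb' ]]]|].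
  by move=> /fI <- /fI <-.
case=> b [b' [ebb' /esym /wedge_meet ax /esym /wedge_meet a'x]].
by rewrite ax a'x edge_irr in eaa'.
Qed.

(** An edge with an end outside the copy of [K] comes from [L], and the two copies meet only in the
    wedge point. *)
Lemma wedge_edge_out u a : edge u (f a) -> u \notin [set f a | a : K] -> a = x.
Proof.
case: (fgW) => _ _ _ _ fgE /fgE[[b [b' [_ <- _]]]|[b [b' [_ _ /esym /wedge_meet //]]]].
by rewrite imset_f.
Qed.

Lemma graph_faces_imset s : s \in graph_faces K -> f @: s \in graph_faces W.
Proof.
case/graph_facesP => [[a ->]|[a [b [eab ->]]]]; first by rewrite imset_set1 graph_faces1.
by rewrite imsetU1 imset_set1 graph_faces2 // wedge_edgel.
Qed.

Lemma pullback_graph_faces : pullback f (graph_faces W) = graph_faces K.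
Proof.
apply/setP => s; rewrite inE; apply/idP/idP; last exact: graph_faces_imset.
have fs := imset_inj wedge_injl.
case/graph_facesP => [[p sE]|[p [q [epq sE]]]].
  have /imsetP[a _ pE] : p \in f @: s by rewrite sE set11.
  move: sE; rewrite pE -imset_set1 => /fs ->; exact: graph_faces1.
have /imsetP[a _ pE] : p \in f @: s by rewrite sE set21.
have /imsetP[b _ qE] : q \in f @: s by rewrite sE set22.
move: sE epq; rewrite pE qE -!imset_set1 -imsetU => /fs -> /wedge_edgel_inv.
exact: graph_faces2.
Qed.

(* The second component drives the induction: a subtree of [W] can only pass
   from one side of the wedge to the other through the wedge point. *)
Lemma tree_complex_pullback (C : {set {set W}}) :
  tree_complex C -> C \subset graph_faces W ->
  (pullback f C = set0 \/ tree_complex (pullback f C)) /\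
  (forall a p, [set f a] \in C -> [set p] \in C -> p \notin [set f a | a : K] ->
     [set f x] \in C).
Proof.
have fs := inj_eq (imset_inj wedge_injl).
have nof v : v \notin [set f a | a : K] -> forall s : {set K}, v \notin f @: s.
  by move=> vf s; apply: contra vf => /imsetP[a _ ->]; rewrite imset_f.
elim=> {C} [v|C u v tC IH uC vC].
  move=> _; split; last first.
    by move=> a p /set1P/set1_inj <- /set1P/set1_inj -> /negP[]; rewrite imset_f.
  have [/imsetP[a _ ->]|vf] := boolP (v \in [set f a | a : K]).
    right; rewrite [pullback _ _](_ : _ = [set [set a]]); first by constructor.
    by apply/setP => s; rewrite !inE -imset_set1 fs.
  left; apply/setP => s; rewrite !inE; apply/negP => /eqP sv.
  by have := nof _ vf s; rewrite sv set11.
rewrite !subUset !sub1set => /and3P[_ uvW CW].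
have [{}IH IHx] := IH CW.
have uv : u != v by apply: contraNneq vC => <-.
have euv : edge u v by apply: graph_faces_edge.
have vertexE p : [set p] \in add_leaf C u v -> p = v \/ [set p] \in C.
  rewrite 2!in_setU1 => /or3P[/eqP/set1_inj|/eqP E|]; [by left| |by right].
  by have := cards1 p; rewrite E cards2 uv.
have inCl p : [set p] \in C -> [set p] \in add_leaf C u v.
  by move=> pC; rewrite 2!in_setU1 pC !orbT.
split; last first.
  move=> a p /vertexE[fav|aC] /vertexE[->|pC] pf.
  - by rewrite -fav imset_f in pf.
  - have [/imsetP[b _ uE]|uf] := boolP (u \in [set f a | a : K]).
      by apply: inCl; apply: (IHx b p) => //; rewrite -uE.
    (* The new leaf lies in the copy of [K] and is attached from outside, so it is the wedge point
       itself. *)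
    rewrite -fav in euv; rewrite -(wedge_edge_out euv uf) fav.
    by rewrite setU11.
  - have [/imsetP[b _ uE]|uf] := boolP (u \in [set f a | a : K]).
      rewrite uE edge_sym in euv; have bx := wedge_edge_out euv pf.
      by apply: inCl; rewrite -bx -uE.
    by apply: inCl; apply: IHx aC uC uf.
  - by apply: inCl; apply: IHx aC pC pf.
(* Three cases: a leaf outside the copy of [K] leaves the pullback unchanged; an edge inside it
   attaches a leaf to the pullback; an edge entering it from outside starts the pullback at [x]. *)
have [/imsetP[a _ vE]|vf] := boolP (v \in [set f a | a : K]); last first.
  rewrite [pullback _ _](_ : _ = pullback f C) //.
  apply/setP => s; rewrite !inE; case: eqVneq => [sv|_].
    by have := nof _ vf s; rewrite sv set11.
  by case: eqVneq => [suv|//]; have := nof _ vf s; rewrite suv set22.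
right; have [/imsetP[b _ uE]|uf] := boolP (u \in [set f a | a : K]).
  have {}IH : tree_complex (pullback f C).
    case: IH => // /setP/(_ [set b]); rewrite inE imset_set1 -uE uC.
    by rewrite inE.
  rewrite [pullback _ _](_ : _ = add_leaf (pullback f C) b a).
    by constructor; rewrite // inE imset_set1 -?uE -?vE.
  apply/setP => s; rewrite !(inE, in_setU1) uE vE -!imset_set1 -imsetU.
  by rewrite !fs.
have ax : a = x by apply: wedge_edge_out uf; rewrite -vE.
(* If [C] already met the copy of [K], then, containing [u] outside it, [C] would contain the wedge
   point, which is the new leaf [v]. *)
have C0 : pullback f C = set0.
  apply/setP => s; rewrite in_set0 inE; apply/negP => sC.
  have Cc := tree_complex_is_complex tC.
  have [c cs] : exists c, c \in s.
    apply/set0Pn; apply: contraTneq sC => ->; rewrite imset0.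
    by have /is_complexP[] := Cc.
  have cC := complex_vertex Cc sC (imset_f f cs).
  by have /negP[] := vC; rewrite vE ax; apply: IHx cC uC uf.
rewrite [pullback _ _](_ : _ = [set [set a]]); first by constructor.
apply/setP => s; have /setP/(_ s) := C0; rewrite !inE => ->.
rewrite vE -imset_set1 fs orbF; case: (s == _) => //=.
apply/negbTE/negP => /eqP E; have /negP[] := nof _ uf s.
by rewrite E !inE eqxx.
Qed.

Lemma gscat_wedgel n : gscat (graph_complex W) <= n -> gscat (graph_complex K) <= n.
Proof.
have W0 : 0 < #|W| by apply/card_gt0P; exists (f x).
have K0 : 0 < #|K| by apply/card_gt0P; exists x.
case/(gscat_leP _ W0) => C tC CE; apply/(gscat_leP _ K0).
(* A tree of the cover that misses [K] is replaced by the vertex [x], so that there are still [n.+1]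
   trees. *)
pose D i := if pullback f (C i) == set0 then [set [set x]] else pullback f (C i).
have CW i : C i \subset graph_faces W by rewrite CE bigcup_sup.
exists D => [i|].
  rewrite /D; case: eqP => [_|nC0]; first by constructor.
  by have [[]] := tree_complex_pullback (tC i) (CW i).
apply/eqP; rewrite eqEsubset; apply/andP; split.
  apply/subsetP => s sK; have := graph_faces_imset sK; rewrite CE.
  case/bigcupP => i _ sC; apply/bigcupP; exists i; rewrite // /D.
  case: eqP => [/setP/(_ s)|_]; last by rewrite inE.
  by rewrite inE sC inE.
apply/bigcupsP => i _; rewrite /D; case: eqP => _.
  by rewrite sub1set graph_faces1.
by rewrite -pullback_graph_faces; apply/subsetP => s; rewrite 2!in_set; apply: (subsetP (CW i)).
Qed.

Lemma connect_wedgel a a' :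
  connect (@edge K) a a' -> connect (@edge W) (f a) (f a').
Proof.
case/connectP => p; elim: p a => [|b p IHp] a /=; first by move=> _ ->.
case/andP => eab pb /(IHp _ pb); apply: connect_trans.
by apply/connect1/wedge_edgel.
Qed.

End WedgeLeft.

(** * The category of a wedge of two connected graphs *)

Section Wedge.

Variables (K L W : sgraph) (x : K) (y : L) (f : K -> W) (g : L -> W).
Hypothesis fgW : wedge_maps x y f g.
Hypotheses (Kc : connected_graph K) (Lc : connected_graph L).

Lemma wedge_vertex p : (exists a, p = f a) \/ exists b, p = g b.
Proof.
case: fgW => _ _ _ /setP/(_ p) + _; rewrite !inE.
by case/orP => /imsetP[a _ ->]; [left | right]; exists a.
Qed.

Lemma connected_wedge : connected_graph W.
Proof.
have gfW := wedge_mapsC fgW.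
have fx : f x = g y by case: fgW.
split; first by apply/card_gt0P; exists (f x).
have [[_ cK] [_ cL]] := (Kc, Lc).
have to_x p : connect (@edge W) p (f x) /\ connect (@edge W) (f x) p.
  case: (wedge_vertex p) => -[a ->]; first by split; apply: (connect_wedgel fgW).
  by rewrite fx; split; apply: (connect_wedgel gfW).
by move=> p q; apply: connect_trans (to_x p).1 (to_x q).2.
Qed.

Lemma gscat_wedge_le n :
  gscat (graph_complex K) <= n -> gscat (graph_complex L) <= n ->
  gscat (graph_complex W) <= n.
Proof.
have gfW := wedge_mapsC fgW.
have fx : f x = g y by case: fgW.
have [[fI gI] _ _ _ fgE] := fgW.
move=> /(gscat_le_spanning Kc)[C CP CE] /(gscat_le_spanning Lc)[D DP DE].
apply/gscat_leP; first by case: connected_wedge.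
exists (fun i => [set f @: (s : {set K}) | s in C i]
                 :|: [set g @: (s : {set L}) | s in D i]) => [i|].
  have [[tC Cv] [tD Dv]] := (CP i, DP i).
  (* Both images contain the wedge point because the trees are spanning, and by [wedge_meet] they
     share no other vertex. *)
  apply: (@tree_complexU _ _ _ (f x)); try exact: tree_complex_imset.
  - by rewrite -imset_set1 imset_f.
  - by rewrite fx -imset_set1 imset_f.
  move=> p /imsetP[s _ sE] /imsetP[t _ tE].
  have /imsetP[a _ pa] : p \in f @: s by rewrite -sE set11.
  have /imsetP[b _ pb] : p \in g @: t by rewrite -tE set11.
  by rewrite pa; congr f; apply: (wedge_meet fgW (b := b)); rewrite -pa.
have inK s : s \in graph_faces K -> exists i,
    f @: s \in [set f @: (s : {set K}) | s in C i].
  by rewrite CE => /bigcupP[i _ sC]; exists i; rewrite imset_f.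
have inL s : s \in graph_faces L -> exists i,
    g @: s \in [set g @: (s : {set L}) | s in D i].
  by rewrite DE => /bigcupP[i _ sC]; exists i; rewrite imset_f.
apply/setP => s; apply/idP/bigcupP => [|[i _ /setUP[]]].
- case/graph_facesP => [[p ->]|[p [q [epq ->]]]].
    case: (wedge_vertex p) => -[a ->]; rewrite -imset_set1.
      by have [i iP] := inK _ (graph_faces1 a); exists i; rewrite // inE iP.
    by have [i iP] := inL _ (graph_faces1 a); exists i; rewrite // inE iP orbT.
  have /fgE[] := epq => -[a [b [eab <- <-]]]; rewrite -!imset_set1 -imsetU.
    by have [i iP] := inK _ (graph_faces2 eab); exists i; rewrite // inE iP.
  by have [i iP] := inL _ (graph_faces2 eab); exists i; rewrite // inE iP orbT.
- case/imsetP => t tC ->; apply: (graph_faces_imset fgW).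
  by rewrite CE; apply/bigcupP; exists i.
- case/imsetP => t tC ->; apply: (graph_faces_imset gfW).
  by rewrite DE; apply/bigcupP; exists i.
Qed.

Lemma gscat_wedge :
  gscat (graph_complex W) = maxn (gscat (graph_complex K)) (gscat (graph_complex L)).
Proof.
apply/eqP; rewrite eqn_leq geq_max gscat_wedge_le ?leq_maxl ?leq_maxr //=.
by rewrite (gscat_wedgel fgW) // (gscat_wedgel (wedge_mapsC fgW)).
Qed.

End Wedge.

(** * Iterated wedges *)

(** Connectedness is carried through the induction because the formula for a single wedge assumes
    both factors connected. *)
Lemma gscat_iterated_wedge (m : nat) (G : nat -> sgraph) (W : sgraph) :
  iterated_wedge G m W ->
  (forall i : nat, 1 <= i <= m -> connected_graph (G i)) ->
  connected_graph W /\
  gscat (graph_complex W) = \max_(1 <= i < m.+1) gscat (graph_complex (G i)).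
Proof.
elim=> {m W} [|k W W' x y _ IH [f [g fgW]]] Gc; first by rewrite big_nat1; split; auto.
have [i /andP[i1 ik]|Wc WE] := IH; first by apply: Gc; rewrite i1 leqW.
have Gk : connected_graph (G k.+1) by apply: Gc; rewrite /= leqnn.
split; first exact: connected_wedge fgW Wc Gk.
by rewrite big_nat_recr //= -WE; apply: gscat_wedge fgW Wc Gk.
Qed.

Theorem corollary19 (m : nat) (G : nat -> sgraph) (W : sgraph) :
  1 <= m ->
  (forall i : nat, 1 <= i <= m -> connected_graph (G i)) ->
  (forall i : nat, 1 <= i <= m -> has_edge (G i)) ->
  iterated_wedge G m W ->
  gscat (graph_complex W) = \max_(1 <= i < m.+1) gscat (graph_complex (G i)).
Proof. by move=> _ Gc _ /gscat_iterated_wedge[]. Qed.
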